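(* Let $f : \mathbb{D} \to \overline{\mathbb{D}}$ be an analytic function, and write $f(z) = \sum_{n=0}^{\infty} a_nz^n$ for $z\in\mathbb{D}$. Then, for each $n\ge 1$ and each $k\ge 1$, we have $$\left|a_{n+k}(1-|a_0|^2)+a_na_k\overline{a_0}\right|^2 \le \left[(1-|a_0|^2)^2-|a_n|^2\right]\cdot \left[(1-|a_0|^2)^2-|a_k|^2\right].$$
   Context: $\mathbb{D}$ is the open unit disk in $\mathbb{C}$ and $\overline{\mathbb{D}}$ is the closed unit disk. *)

(* Defs.v *)
From Stdlib Require Export Reals.
From Coquelicot Require Export Coquelicot.

Open Scope R_scope.

Definition unit_disk (z : C) : Prop := Cmod z < 1.
Definition closed_unit_disk (z : C) : Prop := Cmod z <= 1.

Definition C_pseries (a : nat -> C) (z l : C) : Prop :=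
  @is_pseries C_AbsRing C_NormedModule a z l.

(* Meant for an open set [U]: the radius [r] may then be shrunk so that the
   disc lies in [U], and the values of [f] outside [U] play no role. *)
Definition analytic_on (U : C -> Prop) (f : C -> C) : Prop :=
  forall z0 : C, U z0 ->
    exists (r : posreal) (b : nat -> C),
      forall z : C, Cmod (z - z0) < r -> C_pseries b (z - z0)%C (f z).

(* Main.v *)
Require Import Defs.
From Stdlib Require Import Arith Lra Lia.

(** Multiplication by a function bounded by 1 is a contraction of the Hardy
    space.  Compressing it to the span of [1], [z^k] and [z^(n+k)] shows that
    the matrix
<<
      a_0      0      0
      a_k      a_0    0
      a_(n+k)  a_n    a_0
>>
    is a contraction, and the inequality is what this says about the corner
    entry [a_(n+k)] once the others are given.

    The compression is obtained by elementary means.  If [|f| <= 1] then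
    [2 Re (f p (conj q)) <= |p|^2 + |q|^2] at every point; take for [p] and [q]
    linear combinations of the three monomials and average over a circle.  The
    mean runs over the [N]-th roots of unity, which integrates trigonometric
    polynomials of degree below [N] exactly ([circle_mean_orthonormal]), so [f]
    is first replaced by a Taylor polynomial, which on a circle of radius
    [r < 1] is bounded by [1 + eps] ([partial_sum_le_on_circle]).  Letting [eps]
    go to 0 leaves the contraction property of the matrix with entries
    [a_m r^m] ([toeplitz_form_le]).

    Contractivity is used as a bound on the bilinear form
    [2 Re <A u, v> <= |u|^2 + |v|^2], from which four of the six variables are
    eliminated by giving them their optimal values.  A Hermitian form in two
    variables remains, whose discriminant condition is the wanted inequality
    ([toeplitz_contraction_inequality]).  Finally [r] tends to 1. *)

(** * Complex numbers *)

Lemma RtoC_inj_eq (x y : R) : RtoC x = RtoC y -> x = y.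
Proof. intros H. exact (f_equal fst H). Qed.

Lemma double_Re (z : C) : RtoC (2 * Re z) = (z + Cconj z)%C.
Proof.
  destruct z as [x y]. unfold RtoC, Cplus, Cconj, Re. simpl. f_equal; ring.
Qed.

Lemma Cconj_RtoC (x : R) : Cconj (RtoC x) = RtoC x.
Proof. unfold Cconj, RtoC. simpl. f_equal. ring. Qed.

Lemma Cmod2_RtoC (z : C) : RtoC (Cmod z ^ 2) = (z * Cconj z)%C.
Proof. rewrite <- Cmod2_conj. rewrite RtoC_pow. reflexivity. Qed.

(** The pointwise inequality whose circle mean is the contraction property. *)
Lemma two_Re_mul_le (z p q : C) (K : R) :
  Cmod z <= K ->
  2 * Re (z * p * Cconj q)%C <= K * (Cmod p ^ 2 + Cmod q ^ 2).
Proof.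
  intros H.
  pose proof (re_le_Cmod (z * p * Cconj q)%C) as H1.
  rewrite !Cmod_mult, Cmod_conj in H1.
  pose proof (Rle_abs (Re (z * p * Cconj q)%C)) as H2.
  pose proof (Cmod_ge_0 z). pose proof (Cmod_ge_0 p). pose proof (Cmod_ge_0 q).
  set (P := Cmod p) in *. set (Q := Cmod q) in *.
  assert (Cmod z * P * Q <= K * (P * Q)).
  { rewrite Rmult_assoc. apply Rmult_le_compat_r; nra. }
  assert (0 <= K * (P - Q) ^ 2) by (apply Rmult_le_pos; [lra | apply pow2_ge_0]).
  nra.
Qed.

(** * Roots of unity *)

(** The order of this root is [S N], so that it is positive for every [N] and
    matches the number of terms of [sum_n _ N]. *)
Definition unit_root (N : nat) : C :=
  (cos (2 * PI / INR (S N)), sin (2 * PI / INR (S N))).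

Lemma cis_pow (t : R) (d : nat) :
  ((cos t, sin t) ^ d)%C = (cos (INR d * t), sin (INR d * t)).
Proof.
  induction d as [|d IH].
  - simpl INR. rewrite Rmult_0_l, cos_0, sin_0. reflexivity.
  - rewrite Cpow_S, IH, S_INR, Rmult_plus_distr_r, Rmult_1_l, cos_plus, sin_plus.
    unfold Cmult. simpl. f_equal; ring.
Qed.

Lemma Cmod_cis (t : R) : Cmod (cos t, sin t) = 1.
Proof.
  unfold Cmod. simpl fst. simpl snd.
  pose proof (sin2_cos2 t) as H. unfold Rsqr in H.
  replace (cos t ^ 2 + sin t ^ 2) with 1 by nra.
  apply sqrt_1.
Qed.

Lemma Cmod_unit_root_pow (N s : nat) : Cmod (unit_root N ^ s)%C = 1.
Proof. rewrite Cmod_pow. unfold unit_root. rewrite Cmod_cis. apply pow1. Qed.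

Lemma unit_root_pow_order (N : nat) : (unit_root N ^ S N)%C = 1.
Proof.
  unfold unit_root. rewrite cis_pow.
  replace (INR (S N) * (2 * PI / INR (S N))) with (2 * PI)
    by (field; apply not_0_INR; lia).
  rewrite cos_2PI, sin_2PI. reflexivity.
Qed.

Lemma unit_root_pow_neq_1 (N d : nat) : (0 < d <= N)%nat -> (unit_root N ^ d)%C <> 1.
Proof.
  intros [H0 H1] H. unfold unit_root in H. rewrite cis_pow in H.
  apply (f_equal fst) in H. cbn [fst RtoC] in H.
  pose proof (lt_0_INR (S N) ltac:(lia)) as HN.
  set (x := INR d * PI / INR (S N)).
  replace (INR d * (2 * PI / INR (S N))) with (2 * x) in H
    by (unfold x; field; lra).
  rewrite cos_2a_sin in H.
  (* [x] is half the argument, so [cos (2 x) = 1] would force [sin x = 0],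
     although [x] lies strictly between [0] and [PI]. *)
  assert (0 < sin x); [|nra].
  pose proof PI_RGT_0.
  apply sin_gt_0.
  - unfold x. apply Rdiv_lt_0_compat; [apply Rmult_lt_0_compat; [apply lt_0_INR; lia|lra]|lra].
  - unfold x. apply Rmult_lt_reg_r with (INR (S N)); [lra|].
    replace (INR d * PI / INR (S N) * INR (S N)) with (PI * INR d) by (field; lra).
    apply Rmult_lt_compat_l; [lra|]. apply lt_INR. lia.
Qed.

Lemma geometric_sum (w : C) (N : nat) :
  ((w - 1) * sum_n (fun s => w ^ s) N)%C = (w ^ S N - 1)%C.
Proof.
  induction N as [|N IH].
  - rewrite sum_O. simpl. ring.
  - rewrite sum_Sn. change plus with Cplus.
    rewrite Cmult_plus_distr_l. rewrite IH. rewrite !Cpow_S. ring.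
Qed.

(** * Means over roots of unity *)

Definition circle_mean (N : nat) (F : C -> C) : C :=
  (RtoC (/ INR (S N)) * sum_n (fun s => F (unit_root N ^ s)%C) N)%C.

Lemma circle_mean_ext (N : nat) (F G : C -> C) :
  (forall z, Cmod z = 1 -> F z = G z) -> circle_mean N F = circle_mean N G.
Proof.
  intros H. unfold circle_mean. f_equal. apply sum_n_ext. intros s.
  apply H, Cmod_unit_root_pow.
Qed.

Lemma circle_mean_plus (N : nat) (F G : C -> C) :
  circle_mean N (fun z => F z + G z)%C = (circle_mean N F + circle_mean N G)%C.
Proof.
  unfold circle_mean. rewrite <- Cmult_plus_distr_l. f_equal.
  apply (sum_n_plus (G := C_AbelianMonoid)).
Qed.

Lemma circle_mean_scal (N : nat) (c : C) (F : C -> C) :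
  circle_mean N (fun z => c * F z)%C = (c * circle_mean N F)%C.
Proof.
  unfold circle_mean.
  assert (H : forall M, (c * sum_n (fun s => F (unit_root N ^ s)%C) M)%C
                        = sum_n (fun s => c * F (unit_root N ^ s))%C M).
  { induction M as [|M IH].
    - rewrite !sum_O. reflexivity.
    - rewrite !sum_Sn, <- IH. change plus with Cplus. ring. }
  rewrite <- H. ring.
Qed.

Lemma Re_sum_n_le (F G : nat -> C) (N : nat) :
  (forall s, Re (F s) <= Re (G s)) -> Re (sum_n F N) <= Re (sum_n G N).
Proof.
  intros H. induction N as [|N IH].
  - rewrite !sum_O. apply H.
  - rewrite !sum_Sn. change plus with Cplus. rewrite !re_plus.
    specialize (H (S N)). lra.
Qed.

Lemma Re_circle_mean_le (N : nat) (F G : C -> C) :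
  (forall z, Cmod z = 1 -> Re (F z) <= Re (G z)) ->
  Re (circle_mean N F) <= Re (circle_mean N G).
Proof.
  intros H. unfold circle_mean. rewrite !re_scal_l.
  apply Rmult_le_compat_l.
  - left. apply Rinv_0_lt_compat, lt_0_INR. lia.
  - apply Re_sum_n_le. intros s. apply H, Cmod_unit_root_pow.
Qed.

Lemma circle_mean_1 (N : nat) : circle_mean N (fun _ => 1%C) = 1%C.
Proof.
  unfold circle_mean.
  assert (H : forall M, sum_n (fun _ : nat => RtoC 1) M = RtoC (INR (S M))).
  { induction M as [|M IH].
    - rewrite sum_O. reflexivity.
    - rewrite sum_Sn, IH, (S_INR (S M)), RtoC_plus. reflexivity. }
  rewrite H, <- RtoC_mult. f_equal. field. apply not_0_INR. lia.
Qed.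

Lemma circle_mean_pow (N d : nat) :
  (0 < d <= N)%nat -> circle_mean N (fun z => z ^ d)%C = 0%C.
Proof.
  intros Hd. unfold circle_mean.
  pose proof (geometric_sum (unit_root N ^ d)%C N) as H.
  rewrite <- Cpow_mult_r, Nat.mul_comm, Cpow_mult_r, unit_root_pow_order, Cpow_1_l in H.
  replace (sum_n (fun s => (unit_root N ^ s) ^ d)%C N) with (RtoC 0).
  { ring. }
  rewrite (sum_n_ext _ (fun s => (unit_root N ^ d) ^ s)%C).
  2: { intros s. rewrite <- !Cpow_mult_r. f_equal. lia. }
  pose proof (unit_root_pow_neq_1 N d Hd) as Hne.
  assert (Hne' : (unit_root N ^ d - 1)%C <> 0%C).
  { intros E. apply Hne. replace (unit_root N ^ d)%C with (unit_root N ^ d - 1 + 1)%C by ring.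
    rewrite E. ring. }
  set (Sg := sum_n _ N) in *.
  replace Sg with (/ (unit_root N ^ d - 1) * ((unit_root N ^ d - 1) * Sg))%C
    by (field; exact Hne').
  rewrite H. ring.
Qed.

Lemma circle_mean_conj (N : nat) (F : C -> C) :
  circle_mean N (fun z => Cconj (F z)) = Cconj (circle_mean N F).
Proof.
  unfold circle_mean. rewrite Cmult_conj, Cconj_RtoC. f_equal.
  generalize N at 2 4. intros M. induction M as [|M IH].
  - rewrite !sum_O. reflexivity.
  - rewrite !sum_Sn. change plus with Cplus. rewrite Cplus_conj, IH. reflexivity.
Qed.

Lemma unit_pow_conj (z : C) (i : nat) : Cmod z = 1 -> (z ^ i * Cconj z ^ i)%C = 1%C.
Proof.
  intros H. rewrite <- Cpow_mult_l, <- Cmod2_RtoC, H, pow1. apply Cpow_1_l.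
Qed.

(** On the unit circle conjugation is inversion, so the product collapses to a
    single power of [z] or of its conjugate; the bounds on [i] and [j] exclude
    aliasing modulo the order [S N]. *)
Lemma circle_mean_orthonormal (N i j : nat) :
  (i <= N)%nat -> (j <= N)%nat ->
  circle_mean N (fun z => z ^ i * Cconj z ^ j)%C = if Nat.eqb i j then 1%C else 0%C.
Proof.
  intros Hi Hj. destruct (Nat.eqb_spec i j) as [->|Hne].
  - rewrite <- (circle_mean_1 N). apply circle_mean_ext. intros z Hz.
    apply unit_pow_conj, Hz.
  - destruct (Nat.lt_ge_cases i j) as [Hlt|Hge].
    + rewrite (circle_mean_ext N _ (fun z => Cconj (z ^ (j - i)))%C).
      * rewrite circle_mean_conj, circle_mean_pow by lia. apply Cconj_RtoC.
      * intros z Hz. replace j with (i + (j - i))%nat at 1 by lia.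
        rewrite Cpow_add_r, Cmult_assoc, unit_pow_conj, Cpow_conj by exact Hz. ring.
    + rewrite <- (circle_mean_pow N (i - j)) by lia.
      apply circle_mean_ext. intros z Hz. replace i with (i - j + j)%nat at 1 by lia.
      rewrite Cpow_add_r, <- Cmult_assoc, unit_pow_conj by exact Hz. ring.
Qed.

(** * Mean values of polynomials against trinomials *)

Definition partial_sum (b : nat -> C) (M : nat) (z : C) : C :=
  sum_n (fun l => b l * z ^ l)%C M.

(** A Fourier coefficient of [partial_sum b M] times [z^i], read off term by term.
    Every frequency that occurs is at most [N], so the discrete mean is exact. *)
Lemma circle_mean_coefficient (b : nat -> C) (N M i j : nat) :
  (M + i <= N)%nat -> (j <= N)%nat -> (j <= M)%nat ->
  circle_mean N (fun z => partial_sum b M z * (z ^ i * Cconj z ^ j))%C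
  = if Nat.leb i j then b (j - i)%nat else 0%C.
Proof.
  intros HM HjN HjM.
  assert (H : forall L, (L + i <= N)%nat ->
    circle_mean N (fun z => partial_sum b L z * (z ^ i * Cconj z ^ j))%C
    = if (Nat.leb i j && Nat.leb (j - i) L)%bool then b (j - i)%nat else 0%C).
  { induction L as [|L IH]; intros HL.
    - rewrite (circle_mean_ext N _ (fun z => b 0%nat * (z ^ i * Cconj z ^ j))%C).
      2: { intros z _. unfold partial_sum. rewrite sum_O. simpl. ring. }
      rewrite circle_mean_scal, circle_mean_orthonormal by lia.
      destruct (Nat.eqb_spec i j); destruct (Nat.leb_spec i j);
        destruct (Nat.leb_spec (j - i) 0); simpl; try lia; try ring.
      subst j. rewrite Nat.sub_diag. ring.
    - rewrite (circle_mean_ext N _ (fun z => partial_sum b L z * (z ^ i * Cconj z ^ j)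
         + b (S L) * (z ^ (S L + i) * Cconj z ^ j))%C).
      2: { intros z _. unfold partial_sum. rewrite sum_Sn, Cpow_add_r.
           change plus with Cplus. ring. }
      rewrite circle_mean_plus, circle_mean_scal, circle_mean_orthonormal, IH by lia.
      destruct (Nat.eqb_spec (S L + i) j); destruct (Nat.leb_spec i j);
        destruct (Nat.leb_spec (j - i) L); destruct (Nat.leb_spec (j - i) (S L));
        simpl; try lia; try ring.
      replace (j - i)%nat with (S L) by lia. ring. }
  rewrite H by exact HM.
  destruct (Nat.leb_spec i j); destruct (Nat.leb_spec (j - i) M); simpl; try lia; reflexivity.
Qed.

(** The pairing [<A u, v>] for the lower triangular matrix [A] with [al] on the
    diagonal, [be] and then [ga] just below it, and [de] in the corner. *)
Definition toeplitz_form (al be ga de u1 u2 u3 v1 v2 v3 : C) : C :=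
  (al * (u1 * Cconj v1) + be * (u1 * Cconj v2) + al * (u2 * Cconj v2)
   + de * (u1 * Cconj v3) + ga * (u2 * Cconj v3) + al * (u3 * Cconj v3))%C.

Definition trinomial (k m : nat) (u1 u2 u3 z : C) : C :=
  (u1 + u2 * z ^ k + u3 * z ^ m)%C.

(** Of the nine products of monomials, those that would pick a coefficient of
    negative index have mean 0: this is what makes the matrix triangular.  The
    exponents [0 < k < n + k] must be distinct. *)
Lemma circle_mean_trinomials (b : nat -> C) (N M n k : nat) (u1 u2 u3 v1 v2 v3 : C) :
  (1 <= n)%nat -> (1 <= k)%nat -> (n + k <= M)%nat -> (M + (n + k) <= N)%nat ->
  circle_mean N (fun z => partial_sum b M z * trinomial k (n + k) u1 u2 u3 z
                          * Cconj (trinomial k (n + k) v1 v2 v3 z))%C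
  = toeplitz_form (b 0%nat) (b k) (b n) (b (n + k)%nat) u1 u2 u3 v1 v2 v3.
Proof.
  intros Hn Hk HM HN.
  set (e := fun (i j : nat) (z : C) => (partial_sum b M z * (z ^ i * Cconj z ^ j))%C).
  rewrite (circle_mean_ext N _ (fun z =>
    u1 * Cconj v1 * e 0%nat 0%nat z + (u1 * Cconj v2 * e 0%nat k z
    + (u1 * Cconj v3 * e 0%nat (n + k)%nat z
    + (u2 * Cconj v1 * e k 0%nat z + (u2 * Cconj v2 * e k k z
    + (u2 * Cconj v3 * e k (n + k)%nat z
    + (u3 * Cconj v1 * e (n + k)%nat 0%nat z + (u3 * Cconj v2 * e (n + k)%nat k z
    + u3 * Cconj v3 * e (n + k)%nat (n + k)%nat z))))))))%C).
  2: { intros z _. unfold trinomial, e.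
       rewrite !Cplus_conj, !Cmult_conj, !Cpow_conj. simpl Cpow. ring. }
  rewrite !circle_mean_plus, !circle_mean_scal.
  unfold e. rewrite !circle_mean_coefficient by lia.
  replace (n + k - k)%nat with n by lia.
  rewrite !Nat.sub_diag, !Nat.sub_0_r, !Nat.leb_refl.
  rewrite (leb_correct 0 k), (leb_correct 0 (n + k)), (leb_correct k (n + k)) by lia.
  rewrite (leb_correct_conv 0 k), (leb_correct_conv 0 (n + k)),
    (leb_correct_conv k (n + k)) by lia.
  unfold toeplitz_form. ring.
Qed.

Lemma circle_mean_trinomial_norm (N n k : nat) (u1 u2 u3 : C) :
  (1 <= n)%nat -> (1 <= k)%nat -> ((n + k) + (n + k) <= N)%nat ->
  circle_mean N (fun z => RtoC (Cmod (trinomial k (n + k) u1 u2 u3 z) ^ 2))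
  = RtoC (Cmod u1 ^ 2 + Cmod u2 ^ 2 + Cmod u3 ^ 2).
Proof.
  intros Hn Hk HN.
  (* The case of the constant polynomial 1 of the previous lemma, whose matrix
     is the identity. *)
  set (b := fun l : nat => match l with O => RtoC 1 | S _ => RtoC 0 end).
  assert (Hb : forall z M, partial_sum b M z = 1%C).
  { intros z M. unfold partial_sum. induction M as [|M IH].
    - rewrite sum_O. simpl. ring.
    - rewrite sum_Sn, IH. unfold b. change plus with Cplus. ring. }
  rewrite (circle_mean_ext N _ (fun z => partial_sum b (n + k) z
     * trinomial k (n + k) u1 u2 u3 z * Cconj (trinomial k (n + k) u1 u2 u3 z))%C).
  2: { intros z _. rewrite Hb, Cmod2_RtoC. ring. }
  rewrite circle_mean_trinomials by lia.
  rewrite !RtoC_plus, !Cmod2_RtoC. unfold toeplitz_form, b.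
  destruct n; [lia|]. destruct k; [lia|]. simpl. ring.
Qed.

Lemma toeplitz_form_partial_sum_le (b : nat -> C) (M n k : nat) (K : R)
    (u1 u2 u3 v1 v2 v3 : C) :
  (1 <= n)%nat -> (1 <= k)%nat -> (n + k <= M)%nat ->
  (forall z, Cmod z = 1 -> Cmod (partial_sum b M z) <= K) ->
  2 * Re (toeplitz_form (b 0%nat) (b k) (b n) (b (n + k)%nat) u1 u2 u3 v1 v2 v3)
  <= K * ((Cmod u1 ^ 2 + Cmod u2 ^ 2 + Cmod u3 ^ 2)
          + (Cmod v1 ^ 2 + Cmod v2 ^ 2 + Cmod v3 ^ 2)).
Proof.
  intros Hn Hk HM HK.
  set (N := (M + (n + k))%nat).
  rewrite <- (circle_mean_trinomials b N M) by (unfold N; lia).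
  rewrite <- re_scal_l, <- circle_mean_scal.
  rewrite <- (re_RtoC (K * _)), RtoC_mult, RtoC_plus.
  rewrite <- (circle_mean_trinomial_norm N n k u1), <- (circle_mean_trinomial_norm N n k v1)
    by (unfold N; lia).
  rewrite <- circle_mean_plus, <- circle_mean_scal.
  apply Re_circle_mean_le. intros z Hz.
  rewrite re_scal_l, <- RtoC_plus, re_scal_l, re_RtoC.
  apply two_Re_mul_le, HK, Hz.
Qed.

(** * Contractive triangular Toeplitz matrices of size three *)

(** Taking [y] proportional to [E] makes the cross term real and as large as
    possible, which leaves a real quadratic form in the two scale factors. *)
Lemma quadratic_form_discriminant (p q : R) (E : C) :
  (forall x y : C, 2 * Re (Cconj y * x * E)%C <= p * Cmod x ^ 2 + q * Cmod y ^ 2) ->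
  Cmod E ^ 2 <= p * q.
Proof.
  intros H.
  assert (Ht : forall s t : R,
    2 * (s * t) * Cmod E ^ 2 <= p * s ^ 2 + q * (t ^ 2 * Cmod E ^ 2)).
  { intros s t. specialize (H (RtoC s) (RtoC t * E)%C).
    replace (Cconj (RtoC t * E) * RtoC s * E)%C with (RtoC (s * t * Cmod E ^ 2)) in H.
    2: { rewrite !RtoC_mult, Cmod2_RtoC, Cmult_conj, Cconj_RtoC. ring. }
    rewrite re_RtoC, Cmod_mult, !Cmod_R, Rpow_mult_distr, !pow2_abs in H. lra. }
  pose proof (pow2_ge_0 (Cmod E)) as HE. set (e := Cmod E ^ 2) in *.
  destruct (Rle_lt_or_eq_dec 0 e HE) as [He|He].
  - assert (Hq : 0 < q).
    (* If [q <= 0], the right-hand side at [s = 1] is at most [p], whereas this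
       value of [t] makes the left-hand side equal to [p + 1]. *)
    { pose proof (Ht 1 ((p + 1) / (2 * e))) as H1.
      replace (2 * (1 * ((p + 1) / (2 * e))) * e) with (p + 1) in H1 by (field; lra).
      assert (0 <= ((p + 1) / (2 * e)) ^ 2 * e) by (apply Rmult_le_pos; [apply pow2_ge_0|lra]).
      nra. }
    pose proof (Ht q 1). nra.
  - rewrite <- He in *. pose proof (Ht 1 0).
    pose proof (H 0%C 1%C) as H2. rewrite Cmod_0, Cmod_1 in H2.
    replace (Cconj 1 * 0 * E)%C with (RtoC 0) in H2 by ring.
    rewrite re_RtoC in H2. nra.
Qed.

(** Write [D = 1 - |al|^2].  When [D = 0] both sides equal [|be ga|^2].  When
    [D > 0], minimise [|u|^2 + |v|^2 - 2 Re <A u, v>] over all variables except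
    [u1] and [v3]; [D] times the minimum is a Hermitian form in these two, with
    the two factors of the right-hand side as diagonal coefficients. *)
Lemma toeplitz_contraction_inequality (al be ga de : C) :
  (forall u1 u2 u3 v1 v2 v3 : C,
    2 * Re (toeplitz_form al be ga de u1 u2 u3 v1 v2 v3)
    <= (Cmod u1 ^ 2 + Cmod u2 ^ 2 + Cmod u3 ^ 2)
       + (Cmod v1 ^ 2 + Cmod v2 ^ 2 + Cmod v3 ^ 2)) ->
  Cmod (de * RtoC (1 - Cmod al ^ 2) + ga * be * Cconj al)%C ^ 2
  <= ((1 - Cmod al ^ 2) ^ 2 - Cmod ga ^ 2) * ((1 - Cmod al ^ 2) ^ 2 - Cmod be ^ 2).
Proof.
  intros H.
  set (D := 1 - Cmod al ^ 2).
  assert (HDC : RtoC D = (1 - al * Cconj al)%C).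
  { unfold D. rewrite RtoC_minus, Cmod2_RtoC. reflexivity. }
  assert (HD : 0 <= D).
  (* A contraction has diagonal entries of modulus at most 1: test on the first
     basis vector. *)
  { specialize (H 1%C 0%C 0%C al 0%C 0%C).
    replace (toeplitz_form al be ga de 1 0 0 al 0 0) with (RtoC (Cmod al ^ 2)) in H.
    2: { rewrite Cmod2_RtoC. unfold toeplitz_form. rewrite !Cconj_RtoC. ring. }
    rewrite re_RtoC, Cmod_0, Cmod_1 in H. unfold D. nra. }
  destruct (Rle_lt_or_eq_dec 0 D HD) as [HD0|HD0].
  - set (E := (de * RtoC D + ga * be * Cconj al)%C).
    rewrite Rmult_comm. apply quadratic_form_discriminant. intros x y.
    (* The minimisers for [u1 = D x] and [v3 = D y]; this scaling clears the
       denominator [D] of the optimal [u2]. *)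
    set (u2 := (Cconj al * be * x + Cconj ga * y)%C).
    specialize (H (RtoC D * x) u2 (Cconj al * (RtoC D * y))
                  (al * (RtoC D * x)) (be * (RtoC D * x) + al * u2) (RtoC D * y))%C.
    apply Rmult_le_reg_l with D; [exact HD0|].
    match type of H with ?l <= ?r =>
      assert (HF : r - l = D * (((D ^ 2 - Cmod be ^ 2) * Cmod x ^ 2
                    + (D ^ 2 - Cmod ga ^ 2) * Cmod y ^ 2)
                    - 2 * Re (Cconj y * x * E)%C)) end.
    { apply RtoC_inj_eq. unfold E, u2, toeplitz_form.
      rewrite (RtoC_mult D).
      repeat rewrite ?RtoC_minus, ?RtoC_plus, ?double_Re.
      repeat rewrite ?RtoC_mult, ?RtoC_minus, ?Cmod2_RtoC.
      rewrite ?RtoC_pow.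
      repeat rewrite ?Cplus_conj, ?Cmult_conj, ?Cconj_conj, ?Cconj_RtoC.
      rewrite HDC. ring. }
    lra.
  - rewrite <- HD0. apply Req_le.
    replace (de * RtoC 0 + ga * be * Cconj al)%C with (ga * be * Cconj al)%C by ring.
    rewrite !Cmod_mult, Cmod_conj.
    assert (Hal : Cmod al ^ 2 = 1) by (unfold D in HD0; lra).
    rewrite !Rpow_mult_distr, Hal. ring.
Qed.

(** * Taylor polynomials of bounded functions *)

(** Convergence in the topology of the normed module, turned into an estimate
    for the modulus. *)
Lemma C_pseries_partial_sum (a : nat -> C) (z l : C) :
  C_pseries a z l ->
  forall eps : R, 0 < eps ->
  exists N : nat, forall M : nat, (N <= M)%nat -> Cmod (partial_sum a M z - l)%C < eps.
Proof.
  intros H eps Heps.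
  set (F := @locally_norm C_AbsRing C_NormedModule l).
  assert (HF : F (fun y => Cmod (y - l)%C < eps)).
  { exists (mkposreal eps Heps). intros y Hy. exact Hy. }
  apply (@locally_le_locally_norm C_AbsRing C_NormedModule l) in HF.
  destruct (H _ HF) as [N HN]. exists N. intros M HM. specialize (HN M HM).
  replace (partial_sum a M z)
    with (sum_n (fun k => scal (pow_n z k) (a k) : C_NormedModule) M : C); [exact HN|].
  unfold partial_sum. apply sum_n_ext. intros k.
  change scal with Cmult. rewrite Cmult_comm. reflexivity.
Qed.

Lemma partial_sum_S (a : nat -> C) (M : nat) (z : C) :
  partial_sum a (S M) z = (partial_sum a M z + a (S M) * z ^ S M)%C.
Proof. unfold partial_sum. rewrite sum_Sn. reflexivity. Qed.

Lemma C_pseries_terms_eventually_le_1 (a : nat -> C) (z l : C) :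
  C_pseries a z l ->
  exists N : nat, forall m : nat, (N <= m)%nat -> Cmod (a m) * Cmod z ^ m <= 1.
Proof.
  intros H. destruct (C_pseries_partial_sum a z l H (1 / 2) ltac:(lra)) as [N HN].
  exists (S N). intros [|m] Hm; [lia|].
  pose proof (HN m ltac:(lia)) as H1. pose proof (HN (S m) ltac:(lia)) as H2.
  rewrite <- Cmod_pow, <- Cmod_mult.
  replace (a (S m) * z ^ S m)%C
    with ((partial_sum a (S m) z - l) + - (partial_sum a m z - l))%C
    by (rewrite partial_sum_S; ring).
  eapply Rle_trans; [apply Cmod_triangle|]. rewrite Cmod_opp. lra.
Qed.

(** Comparison with the geometric series of ratio [r / s].  The sum of its terms
    of index [M + 1] to [L + M] is kept in closed form so that induction on [L]
    goes through. *)
Lemma partial_sum_tail_le (a : nat -> C) (N M L : nat) (r s : R) (z : C) :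
  0 < r < s -> Cmod z = r ->
  (forall m : nat, (N <= m)%nat -> Cmod (a m) * s ^ m <= 1) -> (N <= M)%nat ->
  Cmod (partial_sum a (L + M) z - partial_sum a M z)%C
  <= ((r / s) ^ M - (r / s) ^ (L + M)) * (r / (s - r)).
Proof.
  intros Hr Hz Ha HM. induction L as [|L IH].
  - cbn [Nat.add]. replace (_ - _)%C with (RtoC 0) by ring. rewrite Cmod_0. lra.
  - cbn [Nat.add]. rewrite partial_sum_S.
    replace (_ - _)%C with ((partial_sum a (L + M) z - partial_sum a M z)
                            + a (S (L + M)) * z ^ S (L + M))%C by ring.
    eapply Rle_trans; [apply Cmod_triangle|].
    assert (Ht : Cmod (a (S (L + M)) * z ^ S (L + M))%C <= (r / s) ^ S (L + M)).
    { rewrite Cmod_mult, Cmod_pow, Hz.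
      replace r with (s * (r / s)) at 1 by (field; lra).
      rewrite Rpow_mult_distr, <- Rmult_assoc.
      rewrite <- (Rmult_1_l ((r / s) ^ S (L + M))) at 2.
      apply Rmult_le_compat_r; [|apply Ha; lia].
      apply pow_le, Rlt_le, Rdiv_lt_0_compat; lra. }
    replace (((r / s) ^ M - (r / s) ^ S (L + M)) * (r / (s - r)))
      with (((r / s) ^ M - (r / s) ^ (L + M)) * (r / (s - r)) + (r / s) ^ S (L + M)).
    + lra.
    + simpl. field. lra.
Qed.

(** The terms of the series are bounded at the point [s] strictly between [r]
    and 1, so the Taylor polynomials converge uniformly on the circle of radius
    [r], where [f] is bounded by 1. *)
Lemma partial_sum_le_on_circle (f : C -> C) (a : nat -> C) (r eps : R) (N0 : nat) :
  (forall z : C, unit_disk z -> closed_unit_disk (f z)) ->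
  (forall z : C, unit_disk z -> C_pseries a z (f z)) ->
  0 < r < 1 -> 0 < eps ->
  exists M : nat, (N0 <= M)%nat /\
    forall z : C, Cmod z = r -> Cmod (partial_sum a M z) <= 1 + eps.
Proof.
  intros Hf Ha Hr Heps.
  set (s := (r + 1) / 2).
  assert (Hs : r < s < 1) by (unfold s; lra).
  assert (Hsm : Cmod (RtoC s) = s) by (rewrite Cmod_R; apply Rabs_pos_eq; lra).
  destruct (C_pseries_terms_eventually_le_1 a (RtoC s) (f (RtoC s))) as [N1 HN1].
  { apply Ha. unfold unit_disk. lra. }
  rewrite Hsm in HN1.
  assert (Hq : 0 < r / s < 1).
  { split; [apply Rdiv_lt_0_compat; lra|].
    apply Rmult_lt_reg_r with s; [lra|]. unfold Rdiv.
    rewrite Rmult_assoc, Rinv_l by lra. lra. }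
  assert (Hc : 0 < r / (s - r)) by (apply Rdiv_lt_0_compat; lra).
  destruct (pow_lt_1_zero (r / s)) with (y := eps / 2 / (r / (s - r))) as [N2 HN2].
  { rewrite Rabs_pos_eq; lra. }
  { repeat apply Rdiv_lt_0_compat; lra. }
  set (M := (N0 + N1 + N2)%nat). exists M. split; [unfold M; lia|].
  intros z Hz.
  destruct (C_pseries_partial_sum a z (f z)) with (eps := eps / 2) as [N3 HN3].
  { apply Ha. unfold unit_disk. lra. }
  { lra. }
  specialize (HN3 (N3 + M)%nat ltac:(lia)).
  pose proof (partial_sum_tail_le a N1 M N3 r s z ltac:(lra) Hz HN1
    ltac:(unfold M; lia)) as Ht.
  specialize (Hf z ltac:(unfold unit_disk; lra)). unfold closed_unit_disk in Hf.
  specialize (HN2 M ltac:(unfold M; lia)).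
  rewrite Rabs_pos_eq in HN2 by (apply pow_le; lra).
  pose proof (pow_le (r / s) (N3 + M) ltac:(lra)) as Hp.
  apply (Rmult_lt_compat_r _ _ _ Hc) in HN2.
  replace (eps / 2 / (r / (s - r)) * (r / (s - r))) with (eps / 2) in HN2
    by (field; lra).
  pose proof (Rmult_le_pos _ _ Hp (Rlt_le _ _ Hc)).
  replace (partial_sum a M z) with
    (- (partial_sum a (N3 + M) z - partial_sum a M z)
     + ((partial_sum a (N3 + M) z - f z) + f z))%C by ring.
  eapply Rle_trans; [apply Cmod_triangle|]. rewrite Cmod_opp.
  pose proof (Cmod_triangle (partial_sum a (N3 + M) z - f z)%C (f z)).
  lra.
Qed.

(** The contraction property for the function [z |-> f (r z)], whose Taylor
    coefficients are [a l * r ^ l]. *)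
Lemma toeplitz_form_le (f : C -> C) (a : nat -> C) (r : R) (n k : nat)
    (u1 u2 u3 v1 v2 v3 : C) :
  (forall z : C, unit_disk z -> closed_unit_disk (f z)) ->
  (forall z : C, unit_disk z -> C_pseries a z (f z)) ->
  0 < r < 1 -> (1 <= n)%nat -> (1 <= k)%nat ->
  2 * Re (toeplitz_form (a 0%nat) (a k * RtoC (r ^ k)) (a n * RtoC (r ^ n))
            (a (n + k)%nat * RtoC (r ^ (n + k))) u1 u2 u3 v1 v2 v3)%C
  <= (Cmod u1 ^ 2 + Cmod u2 ^ 2 + Cmod u3 ^ 2)
     + (Cmod v1 ^ 2 + Cmod v2 ^ 2 + Cmod v3 ^ 2).
Proof.
  intros Hf Ha Hr Hn Hk.
  set (W := Cmod u1 ^ 2 + Cmod u2 ^ 2 + Cmod u3 ^ 2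
            + (Cmod v1 ^ 2 + Cmod v2 ^ 2 + Cmod v3 ^ 2)).
  assert (HW : 0 <= W).
  { unfold W. pose proof (pow2_ge_0 (Cmod u1)). pose proof (pow2_ge_0 (Cmod u2)).
    pose proof (pow2_ge_0 (Cmod u3)). pose proof (pow2_ge_0 (Cmod v1)).
    pose proof (pow2_ge_0 (Cmod v2)). pose proof (pow2_ge_0 (Cmod v3)). lra. }
  apply le_epsilon. intros eps Heps.
  assert (Hd : 0 < eps / (W + 1)) by (apply Rdiv_lt_0_compat; lra).
  destruct (partial_sum_le_on_circle f a r (eps / (W + 1)) (n + k) Hf Ha Hr Hd)
    as [M [HM HK]].
  set (b := fun l : nat => (a l * RtoC (r ^ l))%C).
  pose proof (toeplitz_form_partial_sum_le b M n k (1 + eps / (W + 1))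
    u1 u2 u3 v1 v2 v3 Hn Hk HM) as H.
  fold W in H.
  replace (a 0%nat) with (b 0%nat) by (unfold b; simpl; ring).
  fold (b k) (b n) (b (n + k)%nat).
  eapply Rle_trans; [apply H|].
  - intros z Hz.
    replace (partial_sum b M z) with (partial_sum a M (RtoC r * z)%C).
    + apply HK. rewrite Cmod_mult, Hz, Cmod_R, Rabs_pos_eq; lra.
    + unfold partial_sum. apply sum_n_ext. intros l. unfold b.
      rewrite Cpow_mult_l, RtoC_pow. apply Cmult_assoc.
  - replace ((1 + eps / (W + 1)) * W) with (W + eps - eps / (W + 1)) by (field; lra).
    lra.
Qed.

Lemma continuous_nonneg_at_1 (g : R -> R) :
  continuity_pt g 1 -> (forall r, 0 < r < 1 -> 0 <= g r) -> 0 <= g 1.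
Proof.
  intros Hc Hg. apply Rnot_lt_le. intros Hneg.
  destruct (Hc (- g 1) ltac:(lra)) as [d [Hd H]].
  set (r := 1 - Rmin (1 / 2) (d / 2)).
  assert (Hm : 0 < Rmin (1 / 2) (d / 2)) by (apply Rmin_glb_lt; lra).
  pose proof (Rmin_l (1 / 2) (d / 2)). pose proof (Rmin_r (1 / 2) (d / 2)).
  specialize (Hg r ltac:(unfold r; lra)).
  assert (Hx : R_dist (g r) (g 1) < - g 1).
  { apply H. split.
    - split; [exact I|]. unfold r. lra.
    - simpl. unfold R_dist, r. rewrite Rabs_left; lra. }
  unfold R_dist in Hx. pose proof (Rle_abs (g r - g 1)). lra.
Qed.

Theorem theorem5p1 :
  forall (f : C -> C) (a : nat -> C),
    analytic_on unit_disk f ->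
    (forall z : C, unit_disk z -> closed_unit_disk (f z)) ->
    (forall z : C, unit_disk z -> C_pseries a z (f z)) ->
    forall n k : nat, (1 <= n)%nat -> (1 <= k)%nat ->
      (Cmod (a (n + k)%nat * RtoC (1 - Cmod (a 0%nat) ^ 2)
             + a n * a k * Cconj (a 0%nat))%C) ^ 2
      <= ((1 - Cmod (a 0%nat) ^ 2) ^ 2 - Cmod (a n) ^ 2)
         * ((1 - Cmod (a 0%nat) ^ 2) ^ 2 - Cmod (a k) ^ 2).
Proof.
  intros f a _ Hf Ha n k Hn Hk.
  set (D := 1 - Cmod (a 0%nat) ^ 2).
  set (E := (a (n + k)%nat * RtoC D + a n * a k * Cconj (a 0%nat))%C).
  (* The inequality for radius [r]: [n + k] is the total weight of both summands
     of [E], so a common power of [r] factors out. *)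
  set (g := fun r : R => (D ^ 2 - Cmod (a n) ^ 2 * (r ^ n) ^ 2)
                         * (D ^ 2 - Cmod (a k) ^ 2 * (r ^ k) ^ 2)
                         - Cmod E ^ 2 * (r ^ (n + k)) ^ 2).
  assert (Hg : 0 <= g 1).
  { apply continuous_nonneg_at_1.
    - apply derivable_continuous_pt. unfold g. reg.
    - intros r Hr.
      pose proof (toeplitz_contraction_inequality _ _ _ _
        (fun u1 u2 u3 v1 v2 v3 =>
           toeplitz_form_le f a r n k u1 u2 u3 v1 v2 v3 Hf Ha Hr Hn Hk)) as H.
      fold D in H.
      replace (_ + _)%C with (E * RtoC (r ^ (n + k)))%C in H
        by (unfold E; rewrite pow_add, RtoC_mult; ring).
      rewrite !Cmod_mult, !Cmod_R, !Rpow_mult_distr, !pow2_abs in H.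
      unfold g. lra. }
  unfold g in Hg. rewrite !pow1, !Rmult_1_r in Hg. lra.
Qed.
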